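(* Let $M$ be a convex multiplicative system of means. Then there exists $p \in [1, \infty]$ such that $M = M_p$, i.e. $M(w, x) = M_p(w, x)$ for every finite set $I$, every $w \in \Delta_I$ and every $x \in \mathbb{R}_+^I$.
   Context: Write $\mathbb{R}_+ = \{x \in \mathbb{R} : x \geq 0\}$. For a finite set $I$, write $\Delta_I = \{ w \in \mathbb{R}_+^I : \sum_{i \in I} w_i = 1 \}$. For a map $f \colon I \to J$ of finite sets and $w \in \Delta_I$, define $fw \in \Delta_J$ by $(fw)_j = \sum_{i \in f^{-1}(j)} w_i$; for $x \in \mathbb{R}_+^J$, define $xf \in \mathbb{R}_+^I$ by $(xf)_i = x_{f(i)}$. For finite sets $I, J$ and $(x, y) \in \Delta_I \times \Delta_J$ or $(x, y) \in \mathbb{R}_+^I \times \mathbb{R}_+^J$, define $x \otimes y = (x_i y_j)_{(i,j) \in I \times J}$, which is an element of $\Delta_{I \times J}$ or $\mathbb{R}_+^{I \times J}$ respectively. A system of means $M$ consists of a function $M \colon \Delta_I \times \mathbb{R}_+^I \to \mathbb{R}_+$ for each finite set $I$, satisfying: (Functoriality) $M(fw, x) = M(w, xf)$ whenever $f \colon I \to J$ is a map of finite sets, $w \in \Delta_I$ and $x \in \mathbb{R}_+^J$; (Consistency) $M((1), (c)) = c$ whenever $c \in \mathbb{R}_+$ and $I$ is a one-element set, where $(1)$ denotes the unique element of $\Delta_I$ and $(c)$ is the element of $\mathbb{R}_+^I$ corresponding to $c$; (Monotonicity) $M(w, x) \leq M(w, y)$ whenever $I$ is a finite set, $w \in \Delta_I$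 and $x, y \in \mathbb{R}_+^I$ with $x_i \leq y_i$ for all $i \in I$. A system of means $M$ is convex if $M(w, \frac{x+y}{2}) \leq \max\{M(w, x), M(w, y)\}$ whenever $I$ is a finite set, $w \in \Delta_I$ and $x, y \in \mathbb{R}_+^I$. It is multiplicative if $M(w \otimes v, x \otimes y) = M(w, x) M(v, y)$ whenever $I$ and $J$ are finite sets, $(w, x) \in \Delta_I \times \mathbb{R}_+^I$ and $(v, y) \in \Delta_J \times \mathbb{R}_+^J$. For $p \in [1, \infty]$, the system of means $M_p$ is defined, for $w \in \Delta_I$ and $x \in \mathbb{R}_+^I$, by $M_p(w, x) = \bigl(\sum_{i \in I} w_i x_i^p\bigr)^{1/p}$ if $p < \infty$, and $M_\infty(w, x) = \max\{x_i : i \in I,\ w_i > 0\}$. *)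

(* Defs.v *)
From HB Require Import structures.
From mathcomp Require Import all_boot all_order all_algebra.
From mathcomp Require Import all_classical all_reals all_analysis.

Set Implicit Arguments.
Unset Strict Implicit.
Unset Printing Implicit Defensive.

Import Order.TTheory GRing.Theory Num.Theory.

Local Open Scope ring_scope.

Section Means.
Variable R : realType.

Definition nonneg_vec (I : finType) (x : I -> R) : Prop :=
  forall i, 0 <= x i.

Definition simplex (I : finType) (w : I -> R) : Prop :=
  nonneg_vec w /\ \sum_(i : I) w i = 1.

(* fw; the vector xf is the composite x \o f. *)
Definition push_weights (I J : finType) (f : I -> J) (w : I -> R) : J -> R :=
  fun j => \sum_(i : I | f i == j) w i.

Definition tensor (I J : finType) (x : I -> R) (y : J -> R) : I * J -> R :=
  fun ij => x ij.1 * y ij.2.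

(* A function Delta_I * R_+^I -> R_+ for each finite set I is represented by a
   function on all pairs of real vectors. Its values off Delta_I * R_+^I are
   arbitrary: every property below is restricted to that domain. *)
Definition mean_family : Type :=
  forall I : finType, (I -> R) -> (I -> R) -> R.

Record system_of_means (M : mean_family) : Prop := SystemOfMeans {
  mean_ge0 : forall (I : finType) (w x : I -> R),
    simplex w -> nonneg_vec x -> 0 <= M I w x;
  mean_functorial : forall (I J : finType) (f : I -> J) (w : I -> R)
      (x : J -> R),
    simplex w -> nonneg_vec x -> M J (push_weights f w) x = M I w (x \o f);
  mean_consistent : forall (I : finType) (c : R),
    #|I| = 1%N -> 0 <= c -> M I (fun=> 1) (fun=> c) = c;
  mean_monotone : forall (I : finType) (w x y : I -> R),
    simplex w -> nonneg_vec x -> nonneg_vec y ->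
    (forall i, x i <= y i) -> M I w x <= M I w y
}.

Definition convex_means (M : mean_family) : Prop :=
  forall (I : finType) (w x y : I -> R),
    simplex w -> nonneg_vec x -> nonneg_vec y ->
    M I w (fun i => (x i + y i) / 2) <= Num.max (M I w x) (M I w y).

Definition multiplicative_means (M : mean_family) : Prop :=
  forall (I J : finType) (w x : I -> R) (v y : J -> R),
    simplex w -> nonneg_vec x -> simplex v -> nonneg_vec y ->
    M (I * J)%type (tensor w v) (tensor x y) = M I w x * M J v y.

(* Only 1 <= p is meaningful; the value at -oo is a placeholder. At +oo the
   default 0 of the iterated maximum has no effect on the domain, where x is
   nonnegative and some w i is positive. *)
Definition power_mean (p : \bar R) (I : finType) (w x : I -> R) : R :=
  match p with
  | EFin r => (\sum_(i : I) w i * x i `^ r) `^ r^-1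
  | +oo%E => \big[Num.max/0]_(i : I | 0 < w i) x i
  | -oo%E => 0
  end.

End Means.

(* Main.v *)
Require Import Defs.
From HB Require Import structures.
From mathcomp Require Import all_boot all_order all_algebra.
From mathcomp Require Import all_classical all_reals all_analysis.
From mathcomp Require Import lra.

Set Implicit Arguments.
Unset Strict Implicit.
Unset Printing Implicit Defensive.

Import Order.TTheory GRing.Theory Num.Theory.

Local Open Scope ring_scope.

(* Let phi(a) be the mean of the indicator of an event of probability a.
   Convexity bounds the mean of a sum of N nonnegative vectors by 2N times the
   largest single mean, so on a finite set L the mean M(u, v) lies between
   max_l v_l phi(u_l) and 2|L| times that maximum: phi determines M up to a
   factor 2|L|. The n-th tensor power of x on I is constant on each type class
   (given by the number of occurrences of each element of I), so by
   functoriality it lives on a set of only (n+1)^|I| elements; taking n-th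
   roots, phi determines M exactly. In turn phi is multiplicative and monotone,
   hence determined by phi(1/2), which lies in [1/2, 1] by convexity. The power
   means of order at least 1 are themselves convex multiplicative systems of
   means, with phi(1/2) = 2^(-1/p), and one of them has the same phi(1/2) as
   M. *)

(** If [t < s], the powers of [s / t] grow exponentially and outrun every polynomial. This is what
    taking n-th roots amounts to. *)
Lemma le_of_expn_le_poly (R : archiRealFieldType) (s t C : R) (k : nat) :
  0 <= s -> 0 <= t ->
  (forall n, s ^+ n <= C * n.+1%:R ^+ k * t ^+ n) -> s <= t.
Proof.
move=> s0 t0 st; rewrite leNgt; apply/negP => lt_ts.
have [t_eq0|t_neq0] := eqVneq t 0.
  by have := st 1%N; rewrite !expr1 t_eq0 mulr0 leNgt -t_eq0 lt_ts.
have tgt0 : 0 < t by rewrite lt_neqAle eq_sym t_neq0.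
(* The cap at 1 makes the base case [h <= 1] of the Bernoulli bound hold. *)
pose h := Num.min 1 (s / t - 1).
have h0 : 0 < h by rewrite lt_min ltr01 subr_gt0 ltr_pdivlMr// mul1r.
have h1 : h <= 1 by rewrite ge_min lexx.
have hst : 1 + h <= s / t.
  by rewrite -lerBrDl ge_min lexx orbT.
have bernoulli n : h * n.+1%:R <= (s / t) ^+ n.
  apply: (@le_trans _ _ ((1 + h) ^+ n)); last first.
    by rewrite lerXn2r// nnegrE ?divr_ge0// addr_ge0// ltW.
  elim: n => [|n IH]; first by rewrite mulr1 expr0.
  rewrite exprS mulrDl mul1r.
  have : h * 1 <= h * (1 + h) ^+ n.
    by rewrite ler_pM2l// exprn_ege1// lerDl ltW.
  by move: IH; rewrite -(natr1 n.+1); lra.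
(* At exponent [n * k.+1] the left side is at least [(h * n.+1%:R) ^+ k.+1], while the right side
   has degree [k] in [n.+1]. The spare factor [n.+1] is therefore bounded, by [B]. *)
pose B := C * k.+1%:R ^+ k / h ^+ k.+1.
have B_ge n : n.+1%:R <= B.
  have := st (n * k.+1)%N; rewrite -ler_pdivrMr ?exprn_gt0//.
  rewrite -expr_div_n exprM.
  have C0 : 0 <= C.
    by have := st 0%N; rewrite !expr0 expr1n !mulr1; apply: le_trans.
  have e1 : (h * n.+1%:R) ^+ k.+1 <= (s / t) ^+ n ^+ k.+1.
    by rewrite lerXn2r// nnegrE ?exprn_ge0 ?divr_ge0// mulr_ge0// ltW.
  move=> /(le_trans e1) e2.
  have e3 : C * (n * k.+1).+1%:R ^+ k <= C * (k.+1%:R * n.+1%:R) ^+ k.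
    rewrite ler_wpM2l// lerXn2r ?nnegrE ?mulr_ge0// -natrM ler_nat.
    by rewrite (mulnS k.+1) addSn ltnS mulnC leq_addl.
  have a0 : 0 < n.+1%:R ^+ k :> R by rewrite exprn_gt0.
  rewrite ler_pdivlMr ?exprn_gt0// -(ler_pM2r a0).
  have := le_trans e2 e3; rewrite !exprMn (exprSr n.+1%:R) !mulrA => e4.
  suff -> : n.+1%:R * h ^+ k.+1 * n.+1%:R ^+ k =
      h ^+ k.+1 * n.+1%:R ^+ k * n.+1%:R by [].
  by rewrite -mulrA mulrC.
have [n Bn] : exists n : nat, B < n.+1%:R.
  exists (Num.bound B); apply: (@lt_trans _ _ (Num.bound B)%:R).
    by apply: archi_boundP; apply: le_trans (B_ge 0%N).
  by rewrite ltr_nat.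
by have := B_ge n; rewrite leNgt Bn.
Qed.

(** * Probability vectors and two-point laws *)

Section Simplex.
Variable R : realType.

Lemma simplex_push (I J : finType) (f : I -> J) (w : I -> R) :
  simplex w -> simplex (push_weights f w).
Proof.
move=> [w0 w1]; split=> [j|]; first by apply: sumr_ge0 => i _; apply: w0.
by rewrite -w1 [RHS](partition_big f predT).
Qed.

Lemma simplex_tensor (I J : finType) (w : I -> R) (v : J -> R) :
  simplex w -> simplex v -> simplex (tensor w v).
Proof.
move=> [w0 w1] [v0 v1]; split=> [[i j]|]; first exact: mulr_ge0.
rewrite -(pair_bigA _ (fun i j => w i * v j))/= -[RHS]w1.
by apply: eq_bigr => i _; rewrite -mulr_sumr v1 mulr1.
Qed.

Lemma sum_simplex01 (I : finType) (w : I -> R) (P : pred I) :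
  simplex w -> 0 <= \sum_(i | P i) w i <= 1.
Proof.
move=> [w0 w1]; rewrite sumr_ge0//= -w1 [leRHS](bigID P)/= lerDl.
exact: sumr_ge0.
Qed.

Lemma simplex_pos (I : finType) (w : I -> R) :
  simplex w -> exists i, 0 < w i.
Proof.
move=> [w0 w1]; case: (pickP (fun i => 0 < w i)) => [i wi|no].
  by exists i.
have := oner_neq0 R; rewrite -w1 big1 ?eqxx// => i _.
by apply/le_anti; rewrite w0 andbT leNgt no.
Qed.

Lemma simplex_card_gt0 (L : finType) (u : L -> R) :
  simplex u -> (0 < #|L|)%N.
Proof. by move=> /simplex_pos[l _]; apply/card_gt0P; exists l. Qed.

Definition bern (a : R) : bool -> R := fun b => if b then a else 1 - a.

Definition indic : bool -> R := fun b => b%:R.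

Lemma simplex_bern a : 0 <= a <= 1 -> simplex (bern a).
Proof.
move=> /andP[a0 a1]; split=> [[]|]; rewrite /bern ?subr_ge0//.
by rewrite big_bool/= addrC subrK.
Qed.

Lemma indic_ge0 : nonneg_vec indic.
Proof. by move=> b; apply: ler0n. Qed.

Lemma push_bern (I : finType) (w : I -> R) (P : pred I) :
  simplex w -> push_weights P w = bern (\sum_(i | P i) w i).
Proof.
move=> sw; apply/funext => -[]; rewrite /push_weights /bern.
  by apply: eq_bigl => i; rewrite eqb_id.
rewrite -sw.2 [in RHS](bigID P)/= addrAC subrr add0r.
by apply: eq_bigl => i; rewrite eqbF_neg.
Qed.

End Simplex.

Arguments indic {R}.
Arguments indic_ge0 {R}.

(** * Means of indicators and bounds by single atoms *)

Section SystemOfMeans.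
Variables (R : realType) (M : mean_family R).
Hypothesis M_means : system_of_means M.

(** A constant vector factors through the map to a point, where consistency applies. *)
Lemma mean_cst (I : finType) (w : I -> R) (c : R) :
  simplex w -> 0 <= c -> M w (fun=> c) = c.
Proof.
move=> sw c0.
have <- := mean_functorial M_means (fun=> tt) sw (x := fun=> c) (fun=> c0).
rewrite (_ : push_weights _ _ = fun=> 1); last first.
  by apply/funext => -[]; rewrite /push_weights -sw.2; apply: eq_bigl => i.
by rewrite (mean_consistent M_means)// card_unit.
Qed.

(** The function phi of the overview, realised on a two-point space. *)
Definition indicator_mean (a : R) : R := M (bern a) indic.

(** The predicate is itself a map to [bool], along which [w] pushes forward to a two-point law. *)
Lemma mean_indicator (I : finType) (w : I -> R) (P : pred I) :
  simplex w ->
  M w (fun i => (P i)%:R) = indicator_mean (\sum_(i | P i) w i).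
Proof.
move=> sw; rewrite /indicator_mean -push_bern//.
by rewrite (mean_functorial M_means)//; exact: indic_ge0.
Qed.

Lemma indicator_mean_ge0 a : 0 <= a <= 1 -> 0 <= indicator_mean a.
Proof.
by move=> a01; apply: (mean_ge0 M_means) (indic_ge0); exact: simplex_bern.
Qed.

Lemma indicator_mean_le1 a : 0 <= a <= 1 -> indicator_mean a <= 1.
Proof.
move=> /simplex_bern sa; rewrite -[leRHS](mean_cst sa)//.
by apply: (mean_monotone M_means) => // -[].
Qed.

Lemma indicator_mean0 : indicator_mean 0 = 0.
Proof.
have s0 : simplex (bern (0 : R)) by apply: simplex_bern; rewrite lexx ler01.
have := mean_indicator pred0 s0; rewrite big_pred0_eq => <-.
exact: mean_cst.
Qed.

Lemma indicator_mean1 : indicator_mean 1 = 1.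
Proof.
have s0 : simplex (bern (1 : R)) by apply: simplex_bern; rewrite lexx ler01.
have := mean_indicator predT s0; rewrite s0.2 => <-.
exact: mean_cst.
Qed.

(** Two complementary events of probability 1/2 have the same mean, and the midpoint of their
    indicators is the constant 1/2. *)
Lemma indicator_mean_half_ge : convex_means M -> 2^-1 <= indicator_mean 2^-1.
Proof.
move=> M_convex.
have h01 : 0 <= (2^-1 : R) <= 1.
  by apply/andP; split; lra.
have sh := simplex_bern h01.
have := M_convex _ _ _ (fun b => (~~ b)%:R) sh indic_ge0 (fun b => ler0n _ _).
rewrite (_ : (fun i => _) = fun=> 2^-1); last first.
  by apply/funext => -[]; rewrite /indic/= ?addr0 ?add0r mul1r.
rewrite (mean_cst sh); last by case/andP: h01.
rewrite (mean_indicator negb sh) (_ : \sum_(i | ~~ i) _ = 2^-1).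
  by rewrite maxxx.
by rewrite (big_pred1 false) => [|[]]//; rewrite /bern; lra.
Qed.

Hypothesis M_mult : multiplicative_means M.

(** Scaling by [c] is tensoring with the vector [c] on a point. *)
Lemma mean_scale (I : finType) (w x : I -> R) (c : R) :
  simplex w -> nonneg_vec x -> 0 <= c ->
  M w (fun i => c * x i) = c * M w x.
Proof.
move=> sw x0 c0.
have s1 : simplex (fun _ : unit => 1 : R).
  by split=> [[]//|]; rewrite big_const card_unit /= addr0.
have := M_mult s1 (fun=> c0) sw x0; rewrite mean_cst// => <-.
rewrite -(mean_functorial M_means (fun i => (tt, i)) sw (x := tensor _ x)).
  congr (M _ _); apply/funext => -[[] i].
  by rewrite /push_weights /tensor/= mul1r (big_pred1 i).
by move=> [[] i]; apply: mulr_ge0.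
Qed.

Lemma indicator_meanM a b : 0 <= a <= 1 -> 0 <= b <= 1 ->
  indicator_mean (a * b) = indicator_mean a * indicator_mean b.
Proof.
move=> a01 b01; have sa := simplex_bern a01; have sb := simplex_bern b01.
rewrite /indicator_mean -(M_mult sa indic_ge0 sb indic_ge0).
rewrite (_ : tensor indic indic = fun ij => (ij.1 && ij.2)%:R); last first.
  by apply/funext => -[[] []]; rewrite /tensor /indic/= ?mulr1 ?mulr0.
rewrite (mean_indicator (fun ij => ij.1 && ij.2)); last exact: simplex_tensor.
by rewrite (big_pred1 (true, true)) // => -[[] []].
Qed.

Lemma indicator_meanX a n : 0 <= a <= 1 ->
  indicator_mean (a ^+ n) = indicator_mean a ^+ n.
Proof.
move=> a01; elim: n => [|n IH]; first by rewrite !expr0 indicator_mean1.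
case/andP: (a01) => a0 a1.
by rewrite !exprS indicator_meanM// ?IH// exprn_ge0// exprn_ile1.
Qed.

(** Write [a] as [(a / b) * b]; by multiplicativity the first factor contributes at most 1. *)
Lemma indicator_mean_le a b :
  0 <= a -> a <= b -> b <= 1 -> indicator_mean a <= indicator_mean b.
Proof.
move=> a0 ab b1; have b0 := le_trans a0 ab.
have [b_eq0|b_neq0] := eqVneq b 0.
  by rewrite (_ : a = b)//; apply/le_anti; rewrite ab b_eq0.
have b_gt0 : 0 < b by rewrite lt_neqAle eq_sym b_neq0.
have ab01 : 0 <= a / b <= 1 by rewrite divr_ge0//= ler_pdivrMr// mul1r.
rewrite -[a](divfK b_neq0) indicator_meanM ?b0//.
by rewrite ler_piMl// ?indicator_mean_le1// indicator_mean_ge0// b0.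
Qed.

Lemma mean_atom (L : finType) (u v : L -> R) (l : L) :
  simplex u -> nonneg_vec v ->
  M u (fun k => v l * (k == l)%:R) = v l * indicator_mean (u l).
Proof.
move=> su v0; rewrite mean_scale//.
by rewrite (mean_indicator (fun k => k == l))// big_pred1_eq.
Qed.

Lemma atom_le_mean (L : finType) (u v : L -> R) (l : L) :
  simplex u -> nonneg_vec v -> v l * indicator_mean (u l) <= M u v.
Proof.
move=> su v0; rewrite -mean_atom//.
apply: (mean_monotone M_means) => // k; have := v0 l; have := v0 k;
  by case: eqP => [->|_]; rewrite ?mulr1 ?mulr0.
Qed.

Hypothesis M_convex : convex_means M.

(** Halve the list repeatedly: a sum of two parts is the midpoint of their doubles, so by convexity
    each halving costs a factor 2. *)
Lemma mean_sum_le (L : finType) (u : L -> R) (T : Type) (y : T -> L -> R)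
    (C : R) (m : nat) (s : seq T) :
  simplex u -> (forall t, nonneg_vec (y t)) -> 0 <= C ->
  (forall t, M u (y t) <= C) -> (size s <= 2 ^ m)%N ->
  M u (fun k => \sum_(t <- s) y t k) <= 2 ^+ m * C.
Proof.
move=> su y0 C0 yC.
have sum0 r : nonneg_vec (fun k => \sum_(t <- r) y t k).
  by move=> k; apply: sumr_ge0 => t _; apply: y0.
elim: m s => [|m IH] s.
  case: s => [|t []]// _; rewrite expr0 mul1r.
    rewrite (_ : (fun _ => _) = fun=> 0) ?mean_cst//.
    by apply/funext => k; rewrite big_nil.
  rewrite (_ : (fun _ => _) = y t)//.
  by apply/funext => k; rewrite big_seq1.
move=> ss; rewrite -(cat_take_drop (2 ^ m) s).
set s1 := take _ _; set s2 := drop _ _.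
have twice r : (size r <= 2 ^ m)%N ->
    M u (fun k => 2 * \sum_(t <- r) y t k) <= 2 ^+ m.+1 * C.
  by move=> /IH; rewrite mean_scale// exprS -mulrA ler_pM2l.
rewrite (_ : (fun k => _) = fun k =>
    (2 * (\sum_(t <- s1) y t k) + 2 * (\sum_(t <- s2) y t k)) / 2); last first.
  by apply/funext => k; rewrite big_cat/= -mulrDr mulrC mulKf.
have dbl0 r : nonneg_vec (fun k => 2 * \sum_(t <- r) y t k).
  by move=> k; rewrite mulr_ge0//; exact: sum0.
apply: le_trans (M_convex su (dbl0 s1) (dbl0 s2)) _.
rewrite ge_max; apply/andP; split; apply: twice.
  by rewrite size_take_min geq_minl.
by rewrite size_drop leq_subLR addnn -mul2n -expnS.
Qed.

Lemma mean_le_atoms (L : finType) (u v : L -> R) (C : R) :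
  simplex u -> nonneg_vec v -> 0 <= C ->
  (forall l, v l * indicator_mean (u l) <= C) ->
  M u v <= 2 * #|L|%:R * C.
Proof.
move=> su v0 C0 vC.
pose y l := fun k => v l * (k == l)%:R.
have y0 l : nonneg_vec (y l) by move=> k; apply: mulr_ge0.
have yC l : M u (y l) <= C by rewrite mean_atom.
have ->: v = fun k => \sum_(l <- enum L) y l k.
  apply/funext => k; rewrite big_enum/= (bigD1 k)//= /y eqxx mulr1.
  rewrite big1 ?addr0//.
  by move=> l; rewrite eq_sym => /negPf ->; rewrite mulr0.
have L0 := simplex_card_gt0 su.
(* With this [m], [#|L| < 2 ^ m <= 2 * #|L|], whence the constant [2 * #|L|]. *)
pose m := (trunc_log 2 #|L|).+1.
apply: le_trans (mean_sum_le (m := m) su y0 C0 yC _) _.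
  by rewrite -cardE ltnW// trunc_log_ltn.
rewrite ler_wpM2r// /m exprS ler_pM2l// -natrX ler_nat.
exact: trunc_logP.
Qed.

End SystemOfMeans.

(* [l i] is the number of occurrences of [i] in a word of length [n]. *)
Definition type_value (R : realType) (I : finType) (x : I -> R) (n : nat)
    (l : {ffun I -> 'I_n.+1}) : R :=
  \prod_i x i ^+ l i.

(** The weights [u] built here are the multinomial law of the type of a word of [n] independent
    letters drawn from [w]. One [u] serves every [M], so that two means can be compared on it. *)
Lemma tensor_power_types (R : realType) (I : finType) (w x : I -> R) (n : nat) :
  simplex w -> nonneg_vec x ->
  exists u : {ffun I -> 'I_n.+1} -> R, simplex u /\
    forall M : mean_family R, system_of_means M -> multiplicative_means M ->
      M _ u (type_value x (n := n)) = M I w x ^+ n.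
Proof.
move=> sw x0.
have val0 m : nonneg_vec (type_value x (n := m)).
  by move=> l; apply: prodr_ge0 => i _; apply: exprn_ge0.
elim: n => [|n [u [su IH]]].
  have s1 : simplex (fun _ : {ffun I -> 'I_1} => 1 : R).
    by split=> [l//|]; rewrite sumr_const card_ffun !card_ord exp1n.
  exists (fun=> 1); split=> // M M_means _; rewrite expr0.
  rewrite (_ : type_value _ (n := _) = fun=> 1) ?mean_cst//.
  by apply/funext => l; apply: big1 => i _; rewrite ord1 expr0.
(* Adding one letter to a word raises its count by one. Counts stay at most [n.+1], so [inord] never
   falls back to its default. *)
pose f (il : I * {ffun I -> 'I_n.+1}) : {ffun I -> 'I_n.+2} :=
  [ffun j => inord (il.2 j + (j == il.1))].
have st := simplex_tensor sw su.
exists (push_weights f (tensor w u)); split; first exact: simplex_push.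
move=> M M_means M_mult.
rewrite (mean_functorial M_means)// exprS -IH// -M_mult//; congr (M _ _ _).
apply/funext => -[i l]; rewrite /tensor /type_value/=.
transitivity (\prod_j (x j ^+ (j == i) * x j ^+ l j)).
  apply: eq_bigr => j _; rewrite ffunE /= -exprD; congr (_ ^+ _).
  by rewrite addnC inordK// -addnS -[n.+2]add1n leq_add// leq_b1.
rewrite big_split/=; congr (_ * _).
rewrite (bigD1 i)//= eqxx expr1 big1 ?mulr1// => j /negPf ->.
by rewrite expr0.
Qed.

(** * Comparison of two systems of means *)

(** On the types, [M] is at most [2 * n.+1%:R ^+ #|I|] times any bound on its atoms. These are
    dominated by the atoms of [P], hence by the mean [P] itself; the polynomial factor disappears on
    taking roots. *)
Lemma mean_le_of_indicator (R : realType) (M P : mean_family R) :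
  system_of_means M -> multiplicative_means M -> convex_means M ->
  system_of_means P -> multiplicative_means P ->
  (forall a, 0 <= a <= 1 -> indicator_mean M a <= indicator_mean P a) ->
  forall (I : finType) (w x : I -> R), simplex w -> nonneg_vec x ->
    M I w x <= P I w x.
Proof.
move=> M_means M_mult M_convex P_means P_mult MP I w x sw x0.
apply: (@le_of_expn_le_poly _ _ _ 2 #|I|).
- exact: mean_ge0.
- exact: mean_ge0.
move=> n; have [u [su uE]] := tensor_power_types n sw x0.
have val0 : nonneg_vec (type_value x (n := n)).
  by move=> l; apply: prodr_ge0 => i _; apply: exprn_ge0.
rewrite -!uE//; rewrite (_ : n.+1%:R ^+ #|I| = #|{ffun I -> 'I_n.+1}|%:R).
  apply: mean_le_atoms => // [|l]; first exact: mean_ge0.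
  apply: le_trans (atom_le_mean P_means P_mult l su val0).
  apply: ler_wpM2l => //; apply: MP.
  by have := sum_simplex01 (pred1 l) su; rewrite big_pred1_eq.
by rewrite card_ffun card_ord natrX.
Qed.

(** Each power of [a] lies between consecutive powers of 1/2, where the two functions agree. Passing
    from one to the next costs at most a factor 2, which roots remove. *)
Lemma indicator_mean_le_of_half (R : realType) (M P : mean_family R) :
  system_of_means M -> multiplicative_means M ->
  system_of_means P -> multiplicative_means P -> convex_means P ->
  indicator_mean M 2^-1 = indicator_mean P 2^-1 ->
  forall a, 0 <= a <= 1 -> indicator_mean M a <= indicator_mean P a.
Proof.
move=> M_means M_mult P_means P_mult P_convex MP a a01.
case/andP: (a01) => a0 a1.
have [a_eq0|a_neq0] := eqVneq a 0; first by rewrite a_eq0 !indicator_mean0.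
have h01 : 0 <= (2^-1 : R) <= 1 by apply/andP; split; lra.
apply: (@le_of_expn_le_poly _ _ _ 2 0).
- exact: indicator_mean_ge0.
- exact: indicator_mean_ge0.
move=> n; rewrite expr0 mulr1.
rewrite -(indicator_meanX M_means)// -(indicator_meanX P_means)//.
have b0 : 0 < a ^+ n by rewrite exprn_gt0// lt_neqAle eq_sym a_neq0.
have b1 : a ^+ n <= 1 by rewrite exprn_ile1.
move: (a ^+ n) b0 b1 => b b0 b1.
(* The exponent [m] is chosen so that [2^-1 ^+ m.+1 <= b <= 2^-1 ^+ m]. *)
pose N := Num.truncn b^-1; pose m := trunc_log 2 N.
have /andP[Nb bN] : N%:R <= b^-1 < N.+1%:R by rewrite truncn_itv// invr_ge0 ltW.
have N0 : (0 < N)%N by rewrite truncn_gt0 invf_ge1.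
have bm : b <= 2^-1 ^+ m.
  rewrite exprVn -[b]invrK lef_pV2 ?posrE ?invr_gt0 ?exprn_gt0//.
  by apply: le_trans Nb; rewrite -natrX ler_nat trunc_logP.
have mb : 2^-1 ^+ m.+1 <= b.
  rewrite exprVn -[b]invrK lef_pV2 ?posrE ?invr_gt0 ?exprn_gt0//.
  by apply: le_trans (ltW bN) _; rewrite -natrX ler_nat trunc_log_ltn.
have hX k : 0 <= (2^-1 : R) ^+ k <= 1.
  by case/andP: h01 => ? ?; rewrite exprn_ge0// exprn_ile1.
apply: (@le_trans _ _ (indicator_mean M (2^-1 ^+ m))).
  by apply: indicator_mean_le => //; [exact: ltW | case/andP: (hX m)].
apply: (@le_trans _ _ (2 * indicator_mean P (2^-1 ^+ m.+1))); last first.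
  by rewrite ler_pM2l// indicator_mean_le//; case/andP: (hX m.+1).
rewrite (indicator_meanX M_means)// (indicator_meanX P_means)// MP.
rewrite exprS mulrA ler_peMl//.
  by rewrite exprn_ge0// indicator_mean_ge0.
have := indicator_mean_half_ge P_means P_convex; lra.
Qed.

Lemma mean_unique (R : realType) (M P : mean_family R) :
  system_of_means M -> multiplicative_means M -> convex_means M ->
  system_of_means P -> multiplicative_means P -> convex_means P ->
  indicator_mean M 2^-1 = indicator_mean P 2^-1 ->
  forall (I : finType) (w x : I -> R), simplex w -> nonneg_vec x ->
    M I w x = P I w x.
Proof.
move=> ? ? ? ? ? ? MP I w x sw x0; apply/le_anti/andP; split.
  by apply: mean_le_of_indicator => //; exact: indicator_mean_le_of_half.
by apply: mean_le_of_indicator => //; exact: indicator_mean_le_of_half.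
Qed.

(** * The maximum mean *)

Lemma maxmean_system (R : realType) : system_of_means (@power_mean R +oo).
Proof.
split.
- by move=> I w x _ x0; exact: bigmax_ge_id.
- move=> I J f w x [w0 w1] x0 /=; apply/le_anti/andP; split.
    apply: bigmax_le => [|j fwj]; first exact: bigmax_ge_id.
    have [i /andP[/eqP fij wi]] : exists i, (f i == j) && (0 < w i).
      apply: contraPP fwj => nex; rewrite /push_weights big1 ?ltxx// => i fij.
      apply/le_anti; rewrite w0 andbT leNgt; apply/negP => wi.
      by apply: nex; exists i; rewrite fij.
    by rewrite -fij; apply: le_bigmax_cond.
  apply: bigmax_le => [|i wi]; first exact: bigmax_ge_id.
  apply: (@bigmax_sup _ _ _ _ (f i)) => //.
  rewrite /push_weights (bigD1 i)//= ltr_wpDr// sumr_ge0//.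
- move=> I c I1 c0 /=.
  have [i _] : exists i : I, i \in I by apply/card_gt0P; rewrite I1.
  apply/le_anti/andP; split; first exact: bigmax_le.
  by apply: (@bigmax_sup _ _ _ _ i).
- move=> I w x y _ _ _ xy; exact: le_bigmax2.
Qed.

Lemma maxmean_convex (R : realType) : convex_means (@power_mean R +oo).
Proof.
move=> I w x y sw x0 y0 /=; apply: bigmax_le => [|i wi].
  by rewrite le_max bigmax_ge_id.
have /= xX := le_bigmax_cond 0 x (wi : (fun i => 0 < w i) i).
have /= yY := le_bigmax_cond 0 y (wi : (fun i => 0 < w i) i).
move: xX yY; set X := bigop _ _ _; set Y := bigop _ _ _ => xX yY.
rewrite le_max.
by case: (leP X Y) => XY; apply/orP; [right|left]; lra.
Qed.

Lemma maxmean_mult (R : realType) : multiplicative_means (@power_mean R +oo).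
Proof.
move=> I J w x v y [w0 w1] x0 [v0 v1] y0 /=.
have pos i j : (0 < tensor w v (i, j)) = (0 < w i) && (0 < v j).
  rewrite /tensor/= !lt_neqAle !(eq_sym 0) mulf_eq0 negb_or w0 v0 !andbT.
  by rewrite mulr_ge0 ?andbT.
apply/le_anti/andP; split.
  apply: bigmax_le => [|[i j]]; first by rewrite mulr_ge0 ?bigmax_ge_id.
  by rewrite pos => /andP[wi vj]; rewrite ler_pM// le_bigmax_cond.
have [i wi] := simplex_pos (conj w0 w1).
have [j vj] := simplex_pos (conj v0 v1).
(* Both maxima are attained: some weight is positive and the entries are at least the default 0. *)
have [i' wi' ->] := eq_bigmax i (fun i => 0 < w i) x wi (fun i _ => x0 i).
have [j' vj' ->] := eq_bigmax j (fun j => 0 < v j) y vj (fun j _ => y0 j).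
apply: (@bigmax_sup _ _ _ _ (i', j')) => //.
by rewrite pos; apply/andP; split.
Qed.

Lemma indicator_maxmean (R : realType) (a : R) :
  0 < a -> indicator_mean (@power_mean R +oo) a = 1.
Proof.
move=> a0; apply/le_anti/andP; split.
  by apply: bigmax_le => // -[].
exact: (@bigmax_sup _ _ _ _ true).
Qed.

(** * Power means of finite exponent *)

Section PowerMean.
Variables (R : realType) (r : R).
Hypothesis r1 : 1 <= r.

Let r0 : 0 < r. Proof. exact: lt_le_trans r1. Qed.

Lemma power_mean_system : system_of_means (@power_mean R r%:E).
Proof.
have rV0 : 0 <= r^-1 by rewrite invr_ge0 ltW.
split.
- by move=> I w x _ _; exact: powR_ge0.
- move=> I J f w x _ _ /=; congr (_ `^ _).
  rewrite [RHS](partition_big f predT)//=; apply: eq_bigr => j _.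
  by rewrite mulr_suml; apply: eq_bigr => i /eqP <-.
- move=> I c I1 c0 /=; rewrite sumr_const I1 mulr1n mul1r -powRrM.
  by rewrite divff ?gt_eqF// powRr1.
- move=> I w x y [w0 _] x0 y0 xy /=.
  apply: ge0_ler_powR => //; rewrite ?nnegrE; last first.
    apply: ler_sum => i _; apply: ler_wpM2l => //.
    by apply: ge0_ler_powR => //; rewrite ?nnegrE// ltW.
  all: by apply: sumr_ge0 => i _; rewrite mulr_ge0// powR_ge0.
Qed.

Lemma powR_midpoint_le (a b : R) : 0 <= a -> 0 <= b ->
  ((a + b) / 2) `^ r <= (a `^ r + b `^ r) / 2.
Proof.
move=> a0 b0; have h01 : 0 <= (2^-1 : R) <= 1 by apply/andP; split; lra.
case/andP: h01 => h0 h1.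
have := @convex_powR R r r1 (Itv01 h0 h1) a b.
rewrite !inE/= !in_itv/= !andbT a0 b0 => /(_ isT isT).
rewrite !convRE/= /unstable.onem => H.
have -> : (a + b) / 2 = 2^-1 * a + (1 - 2^-1) * b by lra.
by apply: le_trans H _; lra.
Qed.

Lemma power_mean_convex : convex_means (@power_mean R r%:E).
Proof.
move=> I w x y [w0 w1] x0 y0 /=.
set X := \sum_i w i * x i `^ r; set Y := \sum_i w i * y i `^ r.
have X0 : 0 <= X by apply: sumr_ge0 => i _; rewrite mulr_ge0// powR_ge0.
have Y0 : 0 <= Y by apply: sumr_ge0 => i _; rewrite mulr_ge0// powR_ge0.
set Z := bigop _ _ _.
have Z0 : 0 <= Z by apply: sumr_ge0 => i _; rewrite mulr_ge0// powR_ge0.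
(* Convexity of the [r]-th power, applied entrywise; the average of [X] and [Y] is then at most the
   larger one. *)
have ZXY : Z <= (X + Y) / 2.
  rewrite /X /Y -big_split/= mulr_suml; apply: ler_sum => i _.
  by rewrite -mulrDr -mulrA ler_wpM2l// powR_midpoint_le.
have rV0 : 0 <= r^-1 by rewrite invr_ge0 ltW.
rewrite le_max; case: (leP X Y) => XY; apply/orP; [right|left];
  apply: ge0_ler_powR; rewrite ?nnegrE//; lra.
Qed.

Lemma power_mean_mult : multiplicative_means (@power_mean R r%:E).
Proof.
move=> I J w x v y [w0 w1] x0 [v0 v1] y0 /=.
rewrite -powRM; first last.
- by apply: sumr_ge0 => i _; rewrite mulr_ge0// powR_ge0.
- by apply: sumr_ge0 => i _; rewrite mulr_ge0// powR_ge0.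
congr (_ `^ _); rewrite big_distrl/=.
rewrite -(pair_bigA _
  (fun i j => tensor w v (i, j) * tensor x y (i, j) `^ r))/=.
apply: eq_bigr => i _; rewrite big_distrr/=; apply: eq_bigr => j _.
by rewrite /tensor/= powRM// mulrACA.
Qed.

Lemma indicator_power_mean a :
  indicator_mean (@power_mean R r%:E) a = a `^ r^-1.
Proof.
(* The entry at [false] contributes 0 to the power [r], which is 0 because [r] is nonzero. *)
rewrite /indicator_mean /bern /indic /= big_bool/= powR1 mulr1 powR0 ?gt_eqF//.
by rewrite mulr0 addr0.
Qed.

End PowerMean.

Theorem theorem1p3 (R : realType) (M : mean_family R)
    (M_means : system_of_means M)
    (M_convex : convex_means M)
    (M_mult : multiplicative_means M) :
  exists p : \bar R, (1 <= p)%E /\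
    forall (I : finType) (w x : I -> R),
      simplex w -> nonneg_vec x -> M I w x = power_mean p w x.
Proof.
have h01 : 0 <= (2^-1 : R) <= 1 by apply/andP; split; lra.
have c_ge := indicator_mean_half_ge M_means M_convex.
have c_le1 := indicator_mean_le1 M_means h01.
(* The value 1 at 1/2 corresponds to the maximum mean; a value in [1/2, 1) gives a finite
   exponent. *)
have [c1|c_neq1] := eqVneq (indicator_mean M 2^-1) 1.
  exists +oo%E; split; first by rewrite leey.
  apply: mean_unique => //.
  - exact: maxmean_system.
  - exact: maxmean_mult.
  - exact: maxmean_convex.
  by rewrite c1 indicator_maxmean// invr_gt0.
set c := indicator_mean M 2^-1 in c_ge c_le1 c_neq1.
have c0 : 0 < c by lra.
have c_lt1 : c < 1 by rewrite lt_neqAle c_neq1.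
have l2 : 0 < ln (2 : R) by rewrite ln_gt0// ltr1n.
have lc : 0 < - ln c by rewrite oppr_gt0 ln_lt0// c0.
have lc2 : - ln c <= ln (2 : R).
  by rewrite -lnV// ler_ln ?posrE ?invr_gt0// -[leRHS]invrK lef_pV2 ?posrE.
pose r := ln 2 / - ln c.
have r1 : 1 <= r by rewrite ler_pdivlMr// mul1r.
exists r%:E; split; first by rewrite lee_fin.
apply: mean_unique => //.
- exact: power_mean_system.
- exact: power_mean_mult.
- exact: power_mean_convex.
rewrite indicator_power_mean// -/c /powR invr_eq0 pnatr_eq0/= lnV ?posrE//.
by rewrite /r invf_div mulrN divfK ?gt_eqF// opprK lnK.
Qed.
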